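(* Let $(\mathcal{M},\theta)$ be a compact metric space with a Borel probability measure $\mu$, and let $\mathcal{R}_N=\{V_i\}_{i=1}^N$ be an equal-measure partition of $\mathcal{M}$. Let $\Omega_N=\prod_{i=1}^N V_i$ be the associated probability space and $\mathbb{E}_N$ the expectation on it. Then for every $r\in T$, $$\mathbb{E}_N\lambda_r[\,\cdot\,]+\mathbb{E}_N\theta^\Delta_r[\,\cdot\,]=\langle\theta^\Delta_r\rangle N^2,$$ and for every non-negative Borel measure $\xi$ on $T$ such that the integrals over $T$ defining $\lambda(\xi,y_1,y_2)$, $\theta^\Delta(\xi,y_1,y_2)$ (for all $y_1,y_2\in\mathcal{M}$) and $\langle\theta^\Delta(\xi)\rangle$ converge, $$\mathbb{E}_N\lambda[\xi,\cdot\,]+\mathbb{E}_N\theta^\Delta[\xi,\cdot\,]=\langle\theta^\Delta(\xi)\rangle N^2.$$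
   Context: Equal-measure partition: a collection $\mathcal{R}_N=\{V_i\}_{i=1}^N$ of measurable subsets of $\mathcal{M}$ with $\mu(\mathcal{M}\setminus\bigcup_iV_i)=0$, $\mu(V_i\cap V_j)=0$ for $i\ne j$, and $\mu(V_i)=N^{-1}$ for all $i$. The probability space is $\Omega_N=\prod_{i=1}^NV_i=\{X_N=(x_1,\dots,x_N):x_i\in V_i\}$ with the product measure $\omega_N=\prod_{i=1}^N N\mu|_{V_i}$, and $\mathbb{E}_NF[\,\cdot\,]=\int_{\Omega_N}F[X_N]\,d\omega_N$. Set of radii: $T=\{\theta(y_1,y_2):y_1,y_2\in\mathcal{M}\}$. Balls: $B_r(y)=\{x:\theta(x,y)<r\}$. $\chi(\mathcal{E},\cdot)$ is the characteristic function of $\mathcal{E}$. Kernels: $\Lambda(B_r(y),x)=\chi(B_r(y),x)-\mu(B_r(y))$, $\lambda_r(y_1,y_2)=\int_{\mathcal{M}}\Lambda(B_r(y),y_1)\Lambda(B_r(y),y_2)\,d\mu(y)$, $\lambda(\xi,y_1,y_2)=\int_T\lambda_r(y_1,y_2)\,d\xi(r)$; $\theta^\Delta_r(y_1,y_2)=\frac12\mu(B_r(y_1)\Delta B_r(y_2))$ (symmetric difference), $\theta^\Delta(\xi,y_1,y_2)=\int_T\theta^\Delta_r(y_1,y_2)\,d\xi(r)$. Averages: $\langle\theta^\Delta_r\rangle=\iint_{\mathcal{M}\times\mathcal{M}}\theta^\Delta_r\,d\mu\,d\mu$, $\langle\theta^\Delta(\xi)\rangle=\int_T\langle\theta^\Delta_r\rangle\,d\xi(r)$.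 Random variables on $\Omega_N$ (indices $i,j$ run over $1,\dots,N$): $\theta^\Delta_r[X_N]=\sum_{i\ne j}\theta^\Delta_r(x_i,x_j)$, $\theta^\Delta[\xi,X_N]=\sum_{i\ne j}\theta^\Delta(\xi,x_i,x_j)$, $\lambda_r[X_N]=\sum_i\lambda_r(x_i,x_i)+\sum_{i\ne j}\lambda_r(x_i,x_j)$, $\lambda[\xi,X_N]=\sum_i\lambda(\xi,x_i,x_i)+\sum_{i\ne j}\lambda(\xi,x_i,x_j)$. *)

(* Defs.v *)
From HB Require Import structures.
From mathcomp Require Import all_boot all_order all_algebra.
From mathcomp Require Import interval_inference.
From mathcomp Require Import all_classical all_reals all_analysis.

Set Implicit Arguments.
Unset Strict Implicit.
Unset Printing Implicit Defensive.

Import Order.TTheory GRing.Theory Num.Theory.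
Import numFieldNormedType.Exports.

Local Open Scope classical_set_scope.
Local Open Scope ring_scope.

(* Only the carrier is shared: that the sigma-algebra is the Borel one of the
   metric is a separate condition, [borel_measurable]. *)
#[short(type="measurableMetricType")]
HB.structure Definition MeasurableMetric d (K : numDomainType) :=
  { M of Metric K M & Measurable d M }.

Definition borel_measurable d (R : realType) (M : measurableMetricType d R) :=
  @measurable d M = <<s @open M >>.

Record equal_measure_partition d (M : measurableType d) (R : realType)
    (mu : probability M R) (N : nat) := EqualMeasurePartition {
  part :> 'I_N -> set M;
  measurable_part : forall i, measurable (part i);
  part_cover : mu (~` \bigcup_i part i) = 0%E;
  part_disjoint : forall i j, i != j -> mu (part i `&` part j) = 0%E;
  part_measure : forall i, mu (part i) = (N%:R^-1)%:E }.

Section part_probability.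
Context d (M : measurableType d) (R : realType) (mu : probability M R) (N : nat).
Variables (V : equal_measure_partition mu N) (i : 'I_N).

(* The measure [N mu|_{V_i}], extended by zero outside [V_i]. *)
Definition part_probability : set M -> \bar R :=
  mscale (N%:R)%:nng (mrestr mu (measurable_part V i)).

HB.instance Definition _ := Measure.on part_probability.

Let part_probability_setT : part_probability [set: M] = 1%E.
Proof.
rewrite /part_probability /mscale /= /mrestr setTI part_measure -EFinM divff//.
by rewrite pnatr_eq0 -lt0n (leq_ltn_trans _ (ltn_ord i)).
Qed.

HB.instance Definition _ :=
  Measure_isProbability.Build _ _ _ part_probability part_probability_setT.

End part_probability.

Section product_probability.
Context d (M : measurableType d) (R : realType).

Definition tcons n (x : M * n.-tuple M) : n.+1.-tuple M := [tuple of x.1 :: x.2].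

Lemma measurable_tcons n : measurable_fun [set: M * n.-tuple M] (@tcons n).
Proof. exact: measurable_cons. Qed.

HB.instance Definition _ n :=
  isMeasurableFun.Build _ _ _ _ (@tcons n) (@measurable_tcons n).

Fixpoint product_probability n :
    ('I_n -> probability M R) -> probability (n.-tuple M) R :=
  match n with
  | 0 => fun _ => dirac [tuple]
  | n.+1 => fun P =>
      distribution (P ord0 \x product_probability (fun i => P (lift ord0 i)))%E
                   (@tcons n)
  end.

Lemma product_probabilityE n (P : 'I_n -> probability M R) (A : 'I_n -> set M) :
  (forall i, measurable (A i)) ->
  product_probability P [set X | forall i, A i (tnth X i)] =
    (\prod_(i < n) P i (A i))%E.
Proof.
elim: n => [|n IH] in P A * => mA.
  rewrite big_ord0 /= diracE mem_set//=.
  by case.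
rewrite big_ord_recl -IH//= /distribution /pushforward/= -product_measure1E//=.
  congr (product_measure1 _ _ _); apply/seteqP; split=> -[x X] /= H.
    split; first by have := H ord0; rewrite tnth0.
    by move=> i; have := H (lift ord0 i); rewrite tnthS.
  case: H => H0 HS i; case: (unliftP ord0 i) => [j ->|->].
    by rewrite tnthS.
  by rewrite tnth0.
rewrite [X in measurable X](_ : _ =
    \big[setI/setT]_(i < n) ((fun X : n.-tuple M => tnth X i) @^-1` A (lift ord0 i))).
  apply: bigsetI_measurable => i _; rewrite -[X in measurable X]setTI.
  exact: measurable_tnth.
rewrite -bigcap_seq; apply/seteqP; split=> X /= H i; first by move=> _; exact: H.
by apply: H; rewrite /= mem_index_enum.
Qed.

End product_probability.

Section partition_expectation.
Context d (M : measurableType d) (R : realType) (mu : probability M R) (N : nat).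
Variable V : equal_measure_partition mu N.

Definition Omega : set (N.-tuple M) := [set X | forall i, V i (tnth X i)].

Definition omega : probability (N.-tuple M) R :=
  product_probability (fun i => part_probability V i).

Definition expect (F : N.-tuple M -> R) : \bar R :=
  (\int[omega]_(X in Omega) (F X)%:E)%E.

End partition_expectation.

Definition radii (R : realType) (M : metricType R) : set R :=
  range (fun y : M * M => mdist y.1 y.2).

Section kernels.
Context d (R : realType) (M : measurableMetricType d R) (mu : probability M R).

(* [ball y r] is the open ball [{x | mdist y x < r}]; it is empty for [r = 0]. *)
Definition Lambda (r : R) (y x : M) : R :=
  \1_(ball y r) x - fine (mu (ball y r)).

Definition lambda_r (r : R) (y1 y2 : M) : R :=
  \int[mu]_y (Lambda r y y1 * Lambda r y y2).

Definition thetaDelta_r (r : R) (y1 y2 : M) : R :=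
  2^-1 * fine (mu (ball y1 r `+` ball y2 r)).

Definition avg_thetaDelta_r (r : R) : R :=
  \int[(mu \x mu)%E]_y thetaDelta_r r y.1 y.2.

(* A Borel measure on the compact set of radii is given as (the restriction to
   that set of) a Borel measure [xi] on the line. *)
Variable xi : {measure set (measurableTypeR R) -> \bar R}.

Definition lambda_xi (y1 y2 : M) : R :=
  \int[xi]_(r in radii M) lambda_r r y1 y2.

Definition thetaDelta_xi (y1 y2 : M) : R :=
  \int[xi]_(r in radii M) thetaDelta_r r y1 y2.

Definition avg_thetaDelta_xi : R :=
  \int[xi]_(r in radii M) avg_thetaDelta_r r.

End kernels.

Section pair_sums.
Context (R : realType) (M : Type) (N : nat).
Variables (k : M -> M -> R) (X : N.-tuple M).

Definition sum_offdiag : R :=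
  \sum_(i < N) \sum_(j < N | j != i) k (tnth X i) (tnth X j).

Definition sum_pairs : R :=
  \sum_(i < N) k (tnth X i) (tnth X i) + sum_offdiag.

End pair_sums.

(* Main.v *)
(** [lambda_r] and [thetaDelta_r] are tied pointwise: [Lambda r y x - Lambda r y x']
    is a difference of indicators, and expanding its square gives
      [lambda_r x x' + thetaDelta_r x x' = (lambda_r x x + lambda_r x' x') / 2].
    Hence the two random variables add up to [N * \sum_i lambda_r x_i x_i], whose
    expectation is [N^2] times the [mu]-average of [lambda_r x x] because the
    parts have measure [1/N].  As [Lambda r y] has mean zero, averaging the
    pointwise identity over pairs shows that this average is the one of
    [thetaDelta_r].

    Integrating over the radii needs Tonelli's theorem although [xi] is not
    assumed sigma-finite.  If [r > 0] and [lambda_r y0 y0 = 0] for one [y0],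
    then almost every ball of radius [r] has full measure, and
    [lambda_r y y = 1 - mu (ball y r)] is nonincreasing over such [r].  Therefore
    countably many points [y_n] suffice to detect the radii at which the kernel
    does not vanish identically, and [xi] is sigma-finite on that set of radii
    because each [lambda_r y_n y_n] is [xi]-integrable. *)

Require Import Defs.
From HB Require Import structures.
From mathcomp Require Import all_boot all_order all_algebra.
From mathcomp Require Import all_classical all_reals all_analysis.
From mathcomp Require Import measurable_realfun.
From mathcomp Require Import ring lra.

Set Implicit Arguments.
Unset Strict Implicit.
Unset Printing Implicit Defensive.

Import Order.TTheory GRing.Theory Num.Theory.
Import numFieldNormedType.Exports.

Local Open Scope classical_set_scope.
Local Open Scope ring_scope.

(** * Distance and balls in a compact metric space *)

Section compact_metric.
Context (R : realType) (M : metricType R).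
Hypothesis M_compact : compact [set: M].

(** Compactness gives a countable base, and one point chosen in each basic set yields a dense
    sequence. *)
Lemma compact_dense_sequence (x0 : M) : exists q : nat -> M,
  forall (x : M) (e : R), 0 < e -> exists n, ball (q n) e x.
Proof.
pose P : pseudoPMetricType R :=
  HB.pack (Metric.sort M) (isPointed.Build M x0).
have [B cB [_ Bx]] := @compact_second_countable R P M_compact.
have /pfcard_geP[B0|/unsquash f] := cB.
  exists (fun=> x0) => x e e0.
  have [V [+ _ _]] := Bx x _ (nbhsx_ballx x e e0).
  by rewrite B0.
(* The default [x0] is taken only when the basic set [f n] is empty. *)
exists (fun n => xget x0 (f n)) => x e e0.
have [V [BV Vx Ve]] := Bx x _ (nbhsx_ballx x e e0).
have [n _ fn] := @surj _ _ _ _ f _ BV.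
exists n; apply/ball_sym/Ve; rewrite /= -fn in Vx *.
exact: (xgetI x0 Vx).
Qed.

Lemma in_ball_sym (x y : M) (e : R) :
  (y \in (ball x e : set M)) = (x \in (ball y e : set M)).
Proof. by apply/idP/idP; rewrite !inE; exact: ball_sym. Qed.

Lemma metric_ball_open (x : M) (e : R) : open (ball x e).
Proof.
rewrite openE => y xy; rewrite /interior -nbhs_ballE.
rewrite ballEmdist/= in xy.
exists (e - mdist x y); first by rewrite /= subr_gt0.
move=> z; rewrite !ballEmdist/= => yz.
by rewrite (le_lt_trans (metric_triangle x y z))// -ltrBrDl.
Qed.

Lemma mdist_continuous : continuous (fun y : M * M => mdist y.1 y.2 : R).
Proof.
move=> -[x y]; apply/cvgrPdist_lt => e e0.
have e2 : 0 < e / 2 by rewrite divr_gt0.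
exists (ball x (e / 2), ball y (e / 2)).
  by split; exact: nbhsx_ballx.
move=> -[x' y'] /= [xx' yy'].
rewrite !ballEmdist/= in xx' yy'.
have := metric_triangle x x' y; have := metric_triangle x' y' y.
have := metric_triangle x' x y'; have := metric_triangle x y y'.
rewrite (metric_sym x' x) (metric_sym y' y) => t1 t2 t3 t4.
by rewrite ltr_norml; apply/andP; split; lra.
Qed.

Lemma radii_compact : compact (radii M).
Proof.
rewrite /radii; apply: continuous_compact.
  by apply: continuous_subspaceT; exact: mdist_continuous.
rewrite (_ : [set: M * M] = [set: M] `*` [set: M]); last by apply/seteqP; split.
exact: compact_setX.
Qed.

Lemma radii_measurable : measurable (radii M : set (measurableTypeR R)).
Proof. exact: (compact_measurable radii_compact). Qed.

End compact_metric.

Section borel_metric.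
Context (R : realType) d (M : measurableMetricType d R).
Hypotheses (M_compact : compact [set: M]) (M_borel : borel_measurable M).

Lemma measurable_metric_ball (x : M) (e : R) : measurable (ball x e).
Proof.
by rewrite M_borel; apply: sub_sigma_algebra; exact: (metric_ball_open x e).
Qed.

(** The sigma-algebra on [M * M] is the product one, so continuity is not enough. By density,
    [mdist x y < r] holds iff some [q n] and some rational [s] satisfy [mdist (q n) x < s] and
    [mdist (q n) y < r - s], which is a countable union of rectangles. *)
Lemma measurable_mdist :
  measurable_fun setT (fun y : M * M => mdist y.1 y.2 : R).
Proof.
have [/eqP ME|/set0P[x0 _]] := boolP ([set: M] == set0).
  move=> _ A _; rewrite (_ : _ `&` _ = set0)//; apply/seteqP; split=> // z _.
  by have : [set: M] z.1 by []; rewrite ME.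
have [q q_dense] := compact_dense_sequence M_compact x0.
apply: (measurability _ (RGenInftyO.measurableE R)) => //.
move=> _ [_ [r ->] <-]; rewrite setTI.
rewrite (_ : _ @^-1` _ = \bigcup_(n : nat) \bigcup_(s : rat)
    (ball (q n) (ratr s : R) `*` ball (q n) (r - ratr s))).
  apply: countable_bigcupT_measurable => // n.
  apply: countable_bigcupT_measurable => // s.
  by apply: measurableX; exact: measurable_metric_ball.
apply/seteqP; split=> [[x y]|[x y] [n _ [s _]]] /=; last first.
  rewrite in_itv/= !ballEmdist/= => -[nx ny].
  rewrite (le_lt_trans (metric_triangle x (q n) y))// metric_sym.
  by rewrite -(subrKC (ratr s) r) ltrD.
rewrite in_itv/= => xyr.
pose e := r - mdist x y; have e0 : 0 < e by rewrite subr_gt0.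
(* With [q n] closer than [e / 4] to [x] and [s] between [e / 4] and [e / 2], the distance from
   [q n] to [y] is below [r - e + e / 4], hence below [r - s]. *)
have [n] := q_dense x (e / 4) ltac:(by rewrite divr_gt0).
rewrite ballEmdist/= => nx.
have : e / 4 < e / 2 by lra.
move=> /rat_in_itvoo[s]; rewrite in_itv/= => /andP[es se].
exists n => //; exists s => //; rewrite !ballEmdist/=; split.
  exact: lt_trans es.
rewrite (le_lt_trans (metric_triangle (q n) x y))//.
have : mdist x y = r - e by rewrite /e; ring.
lra.
Qed.

End borel_metric.

(** * Measurability of the kernels *)

Lemma bounded_integrable d (T : measurableType d) (R : realType)
    (mu : {measure set T -> \bar R}) (c : R) (f : T -> R) :
  (mu setT < +oo)%E ->
  measurable_fun setT f -> (forall x, `|f x| <= c) ->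
  mu.-integrable setT (EFin \o f).
Proof.
move=> muT mf fc; apply: measurable_bounded_integrable => //.
exists c; split=> [|y cy x _ /=]; first exact: num_real.
by rewrite (le_trans (fc x))// ltW.
Qed.

Lemma measurable_fun_section d1 d2 (T1 : measurableType d1)
    (T2 : measurableType d2) (R : realType)
    (m : {sigma_finite_measure set T2 -> \bar R}) (A : T1 -> set T2) :
  measurable [set p | A p.1 p.2] -> measurable_fun setT (fun x => m (A x)).
Proof.
move=> /(measurable_fun_xsection m); congr measurable_fun.
apply/funext => x /=; congr (m _).
by apply/seteqP; split=> y; rewrite xsectionE.
Qed.

Section in_ball.
Context (R : realType) d (M : measurableMetricType d R).
Hypotheses (M_compact : compact [set: M]) (M_borel : borel_measurable M).
Context d' (X : measurableType d') (rho : X -> R) (a b : X -> M).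
Hypotheses (mrho : measurable_fun setT rho)
  (ma : measurable_fun setT a) (mb : measurable_fun setT b).

(** Centre, radius and point all depend on a parameter, so that one statement serves whichever of
    them are fixed or integrated out. *)
Lemma measurable_in_ball : measurable [set x | ball (a x) (rho x) (b x)].
Proof.
have : measurable_fun setT (fun x => mdist (a x) (b x) < rho x).
  apply: measurable_fun_ltr => //.
  exact: (measurableT_comp (measurable_mdist M_compact M_borel)
    (measurable_fun_pair ma mb)).
move=> /(_ measurableT [set true]); rewrite setTI => /(_ _)/=.
rewrite (_ : _ @^-1` _ = [set x | ball (a x) (rho x) (b x)]); first by apply.
by apply/seteqP; split=> x /=; rewrite ballEmdist.
Qed.

End in_ball.

Section kernel_measurability.
Context (R : realType) d (M : measurableMetricType d R) (mu : probability M R).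
Hypotheses (M_compact : compact [set: M]) (M_borel : borel_measurable M).
Context d' (X : measurableType d') (rho : X -> R) (a b : X -> M).
Hypotheses (mrho : measurable_fun setT rho)
  (ma : measurable_fun setT a) (mb : measurable_fun setT b).

Let measurable_ball_section (c : X -> M) : measurable_fun setT c ->
  measurable [set p : X * M | ball (c p.1) (rho p.1) p.2].
Proof.
move=> mc; apply: (@measurable_in_ball _ _ _ M_compact M_borel _ _
  (rho \o fst) (c \o fst) snd) => //; exact: measurableT_comp.
Qed.

Lemma measurable_Lambda :
  measurable_fun setT (fun x => Lambda mu (rho x) (a x) (b x)).
Proof.
apply: measurable_funB.
  rewrite (_ : (fun x => _) = \1_[set x | ball (a x) (rho x) (b x)]).
    exact/measurable_indic/measurable_in_ball.
  by apply/funext => x; rewrite !indicE; congr (_%:R);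
    apply/idP/idP; rewrite !inE.
apply: measurableT_comp => //.
exact: (measurable_fun_section _ (measurable_ball_section ma)).
Qed.

Lemma measurable_thetaDelta_r :
  measurable_fun setT (fun x => thetaDelta_r mu (rho x) (a x) (b x)).
Proof.
apply: measurable_funM => //; apply: measurableT_comp => //.
apply: measurable_fun_section.
by apply: measurableU; apply: measurableD; exact: measurable_ball_section.
Qed.

End kernel_measurability.

(** * The pointwise identity at a fixed radius *)

Lemma probability_lty d (T : measurableType d) (R : realType)
    (mu : probability T R) : (mu setT < +oo)%E.
Proof. by rewrite ltey_eq fin_num_measure. Qed.

Lemma Rintegral_probability_cst d (T : measurableType d) (R : realType)
    (mu : probability T R) (c : R) : \int[mu]_(x in setT) c = c.
Proof.
rewrite Rintegral_cst// -[RHS]mulr1.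
congr (_ * _);
  exact: (congr1 fine (probability_setT mu)).
Qed.

Section fixed_radius.
Context (R : realType) d (M : measurableMetricType d R) (mu : probability M R).
Hypotheses (M_compact : compact [set: M]) (M_borel : borel_measurable M).
Variable r : R.

Let probability_fine (A : set M) : measurable A -> 0 <= fine (mu A) <= 1.
Proof.
move=> mA; rewrite fine_ge0//= -lee_fin fineK ?fin_num_measure//.
exact: probability_le1.
Qed.

Lemma normr_Lambda_le1 y x : `|Lambda mu r y x| <= 1.
Proof.
have /andP[m0 m1] := probability_fine (measurable_metric_ball M_borel y r).
rewrite /Lambda indicE ler_norml; case: (_ \in _) => /=; apply/andP; split; lra.
Qed.

Lemma normr_LambdaM_le1 y x y' x' : `|Lambda mu r y x * Lambda mu r y' x'| <= 1.
Proof. by rewrite normrM mulr_ile1// normr_Lambda_le1. Qed.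

Let measurable_Lambda_center x : measurable_fun setT (Lambda mu r ^~ x).
Proof.
exact: (measurable_Lambda mu M_compact M_borel (rho := cst r) (b := cst x)).
Qed.

Lemma integrable_LambdaM x x' :
  mu.-integrable setT (EFin \o (fun y => Lambda mu r y x * Lambda mu r y x')).
Proof.
apply: (@bounded_integrable _ _ _ _ 1 _ (probability_lty _)).
  exact: measurable_funM.
by move=> y; exact: normr_LambdaM_le1.
Qed.

Lemma lambda_r_ge0 x : 0 <= lambda_r mu r x x.
Proof. by apply: Rintegral_ge0 => y _; rewrite -expr2 sqr_ge0. Qed.

Lemma lambda_r_le1 x : lambda_r mu r x x <= 1.
Proof.
rewrite -[leRHS](Rintegral_probability_cst mu 1).
apply: le_Rintegral => //; first exact: integrable_LambdaM.
  exact: finite_measure_integrable_cst.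
by move=> y _; rewrite (le_trans (ler_norm _))// normr_LambdaM_le1.
Qed.

Lemma thetaDelta_r_ge0 x x' : 0 <= thetaDelta_r mu r x x'.
Proof. by rewrite mulr_ge0 ?invr_ge0// fine_ge0. Qed.

Lemma lambda_rD_thetaDelta_r x x' :
  lambda_r mu r x x' + thetaDelta_r mu r x x' =
  (lambda_r mu r x x + lambda_r mu r x' x') / 2.
Proof.
have Lint := integrable_LambdaM.
(* The integrand is the square of [Lambda mu r y x - Lambda mu r y x']. The ball measures cancel in
   this difference, so the square is the indicator that [y] lies in exactly one of the two balls. *)
have : \int[mu]_y (Lambda mu r y x * Lambda mu r y x +
      Lambda mu r y x' * Lambda mu r y x' -
      2 * (Lambda mu r y x * Lambda mu r y x')) =
    fine (mu (ball x r `+` ball x' r)).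
  have mB : measurable (ball x r `+` ball x' r).
    by apply: measurableU; apply: measurableD; exact: measurable_metric_ball.
  rewrite -[in RHS](setIT (_ `+` _)) -integral_indic//; congr fine.
  apply: eq_integral => y _; congr EFin; rewrite /Lambda !indicE.
  rewrite in_setU !in_setD.
  rewrite (in_ball_sym x) (in_ball_sym x').
  by case: (x \in _); case: (x' \in _) => /=; ring.
rewrite RintegralB//; last 2 first.
- exact: (integrableD measurableT (Lint x x) (Lint x' x')).
- exact: (integrableZl measurableT 2 (Lint x x')).
rewrite RintegralD// RintegralZl//.
rewrite -/(lambda_r mu r x x) -/(lambda_r mu r x' x') -/(lambda_r mu r x x').
rewrite /thetaDelta_r => <-; lra.
Qed.

(** The square of the sum of the two [Lambda] terms bounds [lambda_r mu r x x'] from below by minus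
    half the diagonal sum; the pointwise identity turns this into the claim. Integrability and
    vanishing thus pass from the diagonal to [thetaDelta_r]. *)
Lemma thetaDelta_r_le x x' :
  thetaDelta_r mu r x x' <= lambda_r mu r x x + lambda_r mu r x' x'.
Proof.
have Lint := integrable_LambdaM.
have : 0 <= \int[mu]_y (Lambda mu r y x * Lambda mu r y x +
     Lambda mu r y x' * Lambda mu r y x' + 2 * (Lambda mu r y x * Lambda mu r y x')).
  apply: Rintegral_ge0 => y _.
  have -> (a b : R) : a * a + b * b + 2 * (a * b) = (a + b) ^+ 2 by ring.
  exact: sqr_ge0.
rewrite RintegralD//; last 2 first.
- exact: (integrableD measurableT (Lint x x) (Lint x' x')).
- exact: (integrableZl measurableT 2 (Lint x x')).
rewrite RintegralD// RintegralZl//.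
rewrite -/(lambda_r mu r x x) -/(lambda_r mu r x' x') -/(lambda_r mu r x x').
have := lambda_rD_thetaDelta_r x x'; have := thetaDelta_r_ge0 x x'.
lra.
Qed.

End fixed_radius.

(** * Joint measurability of the covariance kernel *)

Section covariance_measurability.
Context (R : realType) d (M : measurableMetricType d R) (mu : probability M R).
Hypotheses (M_compact : compact [set: M]) (M_borel : borel_measurable M).
Context d' (X : measurableType d') (rho : X -> R).
Hypothesis mrho : measurable_fun setT rho.

(** On the diagonal the integrand is a square, so Tonelli's measurability statement applies. *)
Lemma measurable_lambda_r_diag (a : X -> M) : measurable_fun setT a ->
  measurable_fun setT (fun x => lambda_r mu (rho x) (a x) (a x)).
Proof.
move=> ma; apply: measurableT_comp => //.
pose f (p : X * M) := (Lambda mu (rho p.1) p.2 (a p.1) ^+ 2)%:E.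
apply: (@measurable_fun_fubini_tonelli_F _ _ _ _ _ mu f).
  apply/measurable_EFinP/measurable_funX.
  apply: (measurable_Lambda mu M_compact M_borel (rho := rho \o fst)
    (a := snd) (b := a \o fst)) => //; exact: measurableT_comp.
by move=> p; rewrite lee_fin sqr_ge0.
Qed.

(** Off the diagonal the integrand changes sign; the pointwise identity expresses the kernel through
    non-negative ones. *)
Lemma measurable_lambda_r (a b : X -> M) :
  measurable_fun setT a -> measurable_fun setT b ->
  measurable_fun setT (fun x => lambda_r mu (rho x) (a x) (b x)).
Proof.
move=> ma mb; rewrite (_ : (fun x => _) = (fun x =>
    (lambda_r mu (rho x) (a x) (a x) + lambda_r mu (rho x) (b x) (b x)) * 2^-1
    - thetaDelta_r mu (rho x) (a x) (b x))).
  apply: measurable_funB; last exact: measurable_thetaDelta_r.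
  apply: measurable_funM => //.
  by apply: measurable_funD; exact: measurable_lambda_r_diag.
by apply/funext => x; rewrite -lambda_rD_thetaDelta_r// addrK.
Qed.

End covariance_measurability.

(** * Averages over the space at a fixed radius *)

Section fixed_radius_average.
Context (R : realType) d (M : measurableMetricType d R) (mu : probability M R).
Hypotheses (M_compact : compact [set: M]) (M_borel : borel_measurable M).
Variable r : R.

Lemma integrable_lambda_r_diag :
  mu.-integrable setT (EFin \o (fun x => lambda_r mu r x x)).
Proof.
apply: (@bounded_integrable _ _ _ _ 1 _ (probability_lty _)).
  exact: (measurable_lambda_r_diag mu M_compact M_borel (measurable_cst r)
    (@measurable_id _ _ setT)).
by move=> x; rewrite ger0_norm ?lambda_r_ge0// lambda_r_le1.
Qed.

Lemma Rintegral_Lambda y : \int[mu]_x Lambda mu r y x = 0.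
Proof.
have mB := measurable_metric_ball M_borel y r.
rewrite RintegralB//; last 2 first.
- exact: integrable_indic.
- exact: finite_measure_integrable_cst.
by rewrite Rintegral_probability_cst {1}/Rintegral integral_indic// setIT subrr.
Qed.

(** After exchanging the integrals, the inner one is a multiple of the mean of [Lambda mu r z],
    which is zero. Fubini applies because the integrand is bounded and the product measure
    finite. *)
Lemma integral_lambda_r x : (\int[mu]_y (lambda_r mu r x y)%:E = 0)%E.
Proof.
pose f (p : M * M) := Lambda mu r p.2 x * Lambda mu r p.2 p.1.
have mf : measurable_fun setT f.
  apply: measurable_funM.
    exact: (measurable_Lambda mu M_compact M_borel (rho := cst r) (b := cst x)
      (a := snd)).
  exact: (measurable_Lambda mu M_compact M_borel (rho := cst r) (b := fst)
    (a := snd)).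
have intf : (mu \x mu)%E.-integrable setT (EFin \o f).
  apply: (@bounded_integrable _ _ _ _ 1) => // [|p].
    rewrite -setXTT.
    rewrite [X in (X < _)%E](product_measure1E mu mu measurableT measurableT).
    by rewrite -ge0_fin_numE ?mule_ge0// fin_numM// fin_num_measure.
  exact: normr_LambdaM_le1.
transitivity (\int[mu]_y \int[mu]_z (EFin \o f) (y, z))%E.
  apply: eq_integral => y _; rewrite fineK//.
  apply: integrable_fin_num => //; exact: integrable_LambdaM.
rewrite Fubini//; apply: integral0_eq => z _.
have intL : mu.-integrable setT (EFin \o Lambda mu r z).
  apply: (@bounded_integrable _ _ _ _ 1 _ (probability_lty _)); last first.
    by move=> y; exact: normr_Lambda_le1.
  exact: (measurable_Lambda mu M_compact M_borel (rho := cst r) (a := cst z)).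
under eq_integral do rewrite /f /= EFinM.
rewrite integralZl// -[X in (_ * X)%E]fineK; last exact: integrable_fin_num.
by rewrite [fine _](Rintegral_Lambda z) mule0.
Qed.

Lemma integrable_lambda_r x :
  mu.-integrable setT (EFin \o (fun y => lambda_r mu r x y)).
Proof.
apply: (@bounded_integrable _ _ _ _ 1 _ (probability_lty _)).
  exact: (measurable_lambda_r mu M_compact M_borel (measurable_cst r)
    (measurable_cst x) (@measurable_id _ _ setT)).
(* The value is half the diagonal sum minus a [thetaDelta_r] lying between 0 and that sum, so its
   absolute value is at most half the sum, hence at most 1. *)
move=> y; have := lambda_r_le1 mu M_compact M_borel r x.
have := lambda_r_le1 mu M_compact M_borel r y.
have := lambda_rD_thetaDelta_r mu M_compact M_borel r x y.
have := thetaDelta_r_le mu M_compact M_borel r x y.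
have := thetaDelta_r_ge0 mu r x y.
by move=> ? ? ? ? ?; rewrite ler_norml; apply/andP; split; lra.
Qed.

Lemma Rintegral_thetaDelta_r x : \int[mu]_y thetaDelta_r mu r x y =
  (lambda_r mu r x x + \int[mu]_y lambda_r mu r y y) / 2.
Proof.
have intl := integrable_lambda_r_diag.
have intx : mu.-integrable setT (EFin \o (fun=> lambda_r mu r x x)).
  exact: finite_measure_integrable_cst.
transitivity (\int[mu]_y ((lambda_r mu r x x + lambda_r mu r y y) * 2^-1 -
    lambda_r mu r x y)).
  apply: eq_Rintegral => y _.
  have := lambda_rD_thetaDelta_r mu M_compact M_borel r x y; lra.
have intD := integrableD measurableT intx intl.
rewrite RintegralB//; last 2 first.
- exact: (integrableZr measurableT 2^-1 intD).
- exact: integrable_lambda_r.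
rewrite RintegralZr// RintegralD// Rintegral_probability_cst.
by rewrite [X in _ - X](congr1 fine (integral_lambda_r x)) subr0.
Qed.

(** The average over the second variable is half of [lambda_r mu r x x] plus half of [L]; averaging
    over [x] makes both halves equal. *)
Lemma avg_thetaDelta_rE :
  avg_thetaDelta_r mu r = \int[mu]_x lambda_r mu r x x.
Proof.
pose L := \int[mu]_x lambda_r mu r x x.
have intl := integrable_lambda_r_diag.
have mtheta x : measurable_fun setT (fun y => thetaDelta_r mu r x y).
  exact: (measurable_thetaDelta_r mu M_compact M_borel (measurable_cst r)
    (measurable_cst x) (@measurable_id _ _ setT)).
have inttheta x : mu.-integrable setT (EFin \o thetaDelta_r mu r x).
  apply: (@bounded_integrable _ _ _ _ 2 _ (probability_lty _)) => // y.
  rewrite ger0_norm ?thetaDelta_r_ge0//.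
  rewrite (le_trans (thetaDelta_r_le mu M_compact M_borel r x y))//.
  by rewrite -[leRHS]/(1 + 1) lerD// lambda_r_le1.
transitivity (\int[mu]_x (\int[mu]_y thetaDelta_r mu r x y)).
  rewrite /avg_thetaDelta_r {1 2}/Rintegral.
  rewrite (fubini_tonelli1 (fun y : M * M => (thetaDelta_r mu r y.1 y.2)%:E)).
  - congr fine; apply: eq_integral => x _.
    rewrite fineK//; exact: integrable_fin_num (inttheta x).
  - apply/measurable_EFinP.
    exact: (measurable_thetaDelta_r mu M_compact M_borel (measurable_cst r)
      measurable_fst measurable_snd).
  - by move=> y; rewrite lee_fin thetaDelta_r_ge0.
under eq_Rintegral do rewrite Rintegral_thetaDelta_r -/L.
have intL : mu.-integrable setT (EFin \o (fun=> L)).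
  exact: finite_measure_integrable_cst.
rewrite RintegralZr//; last exact: (integrableD measurableT intl intL).
rewrite RintegralD// Rintegral_probability_cst -/L; lra.
Qed.

End fixed_radius_average.

(** * Expectations over an equal-measure partition *)

Lemma ge0_integral_mrestr d (T : measurableType d) (R : realType)
    (mu : {measure set T -> \bar R}) (D : set T) (mD : measurable D)
    (f : T -> \bar R) : measurable_fun setT f -> (forall x, 0 <= f x)%E ->
  (\int[mrestr mu mD]_x f x = \int[mu]_(x in D) f x)%E.
Proof.
move=> mf f0; rewrite [LHS](ge0_negligible_integral (measurableC mD))//; last first.
  by rewrite /= /mrestr setICl measure0.
rewrite setTD setCK; apply: eq_measure_integral => A mA AD.
by rewrite /= /mrestr setIidl.
Qed.

Lemma measurable_tuple_rect d (T : measurableType d) n (A : 'I_n -> set T) :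
  (forall i, measurable (A i)) ->
  measurable [set X : n.-tuple T | forall i, A i (tnth X i)].
Proof.
move=> mA; rewrite (_ : [set X | _] =
    \big[setI/setT]_(i < n) ((fun X : n.-tuple T => tnth X i) @^-1` A i)).
  apply: bigsetI_measurable => i _; rewrite -[X in measurable X]setTI.
  exact: measurable_tnth.
rewrite -bigcap_seq; apply/seteqP; split=> X /= H i; first by move=> _; exact: H.
by apply: H; rewrite /= mem_index_enum.
Qed.

Section partition_expectation.
Context d (M : measurableType d) (R : realType) (mu : probability M R) (N : nat).
Variable V : equal_measure_partition mu N.

Let mV i : measurable (V i) := measurable_part V i.

Let N_neq0 (i : 'I_N) : N%:R != 0 :> R.
Proof. by rewrite pnatr_eq0 -lt0n (leq_ltn_trans _ (ltn_ord i)). Qed.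

Lemma measurable_Omega : measurable (Omega V).
Proof. exact: measurable_tuple_rect. Qed.

Lemma omega_Omega : omega V (Omega V) = 1%E.
Proof.
rewrite /omega /Omega product_probabilityE//; apply: big1 => i _.
rewrite /= /part_probability /mscale/= /mrestr setIid part_measure -EFinM.
by rewrite divff// N_neq0.
Qed.

Lemma omega_marginal i (A : set M) : measurable A ->
  omega V [set X | A (tnth X i)] = part_probability V i A.
Proof.
(* The cylinder is a box with the whole space as every side but one. *)
move=> mA; pose B j := if j == i then A else setT.
rewrite (_ : [set X | _] = [set X : N.-tuple M | forall j, B j (tnth X j)]).
  rewrite /omega product_probabilityE => [|j]; last by rewrite /B; case: ifP.
  rewrite (bigD1 i)//= /B eqxx big1 ?mule1// => j /negPf ->.
  exact: probability_setT.
apply/seteqP; split => X /= H; last by have := H i; rewrite /B eqxx.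
by move=> j; rewrite /B; case: eqP => // ->.
Qed.

(** [Omega V] has full measure, so the integral may be taken over all tuples and pushed forward
    along the [i]-th coordinate to the marginal [part_probability V i]. *)
Lemma integral_omega_tnth i (g : M -> \bar R) :
  measurable_fun setT g -> (forall x, 0 <= g x)%E ->
  (\int[omega V]_(X in Omega V) g (tnth X i) =
   N%:R%:E * \int[mu]_(x in V i) g x)%E.
Proof.
move=> mg g0.
have mt : measurable_fun setT (fun X : N.-tuple M => tnth X i).
  exact: measurable_tnth.
have mO := measurable_Omega.
have OC0 : omega V (~` Omega V) = 0%E.
  by rewrite probability_setC// [X in (_ - X)%E]omega_Omega subee.
rewrite -[in LHS](setCK (Omega V)) -setTD.
rewrite -(ge0_negligible_integral (measurableC mO))//; last exact: measurableT_comp.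
rewrite -[LHS](ge0_integral_pushforward mt _ measurableT)//.
rewrite (eq_measure_integral (part_probability V i)); last first.
  by move=> A mA _; exact: omega_marginal.
rewrite [LHS]ge0_integral_mscale//; congr (_ * _)%E.
exact: ge0_integral_mrestr.
Qed.

Lemma sum_indic_part : \forall x \ae mu, \sum_(i < N) (\1_(V i) x : R) = 1.
Proof.
have VV (i j : 'I_N) : \forall x \ae mu, i != j -> ~ (V i `&` V j) x.
  have [->|ij] := eqVneq i j; first exact: aeW.
  exists (V i `&` V j); split; [exact: measurableI|exact: part_disjoint|].
  by move=> x /= /not_implyP[_ /contrapT].
(* Almost every point lies in some part, and in no two distinct ones, so exactly one indicator
   equals 1. *)
have Vcover : \forall x \ae mu, (\bigcup_i V i) x.
  exists (~` \bigcup_i V i); split => //; last exact: part_cover.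
  apply: measurableC; apply: countable_bigcupT_measurable => //.
have VVall : \forall x \ae mu, forall i j, i != j -> ~ (V i `&` V j) x.
  by apply: filter_forall => i; exact: filter_forall.
near=> x.
have [i _ Vix] : (\bigcup_i V i) x by near: x.
have VVx : forall i j, i != j -> ~ (V i `&` V j) x by near: x.
rewrite (bigD1 i)//= indicE mem_set// big1 ?addr0// => j ji.
rewrite indicE memNset// => Vjx.
exact: (VVx j i).
Unshelve. all: by end_near. Qed.

Lemma sum_integral_part (g : M -> \bar R) :
  measurable_fun setT g -> (forall x, 0 <= g x)%E ->
  (\sum_(i < N) \int[mu]_(x in V i) g x = \int[mu]_x g x)%E.
Proof.
move=> mg g0.
transitivity (\sum_(i < N) \int[mu]_x ((\1_(V i) x)%:E * g x))%E.
  apply: eq_bigr => i _; rewrite integral_mkcond; apply: eq_integral => x _.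
  by rewrite patchE indicE; case: ifPn => _; rewrite ?mul1e ?mul0e.
rewrite -ge0_integral_sum//; last 2 first.
- move=> i; apply: emeasurable_funM => //.
  exact/measurable_EFinP/measurable_indic.
- by move=> i x _; rewrite mule_ge0.
have mVg i : measurable_fun setT (fun x => (\1_(V i) x)%:E * g x)%E.
  by apply: emeasurable_funM => //; exact/measurable_EFinP/measurable_indic.
apply: ge0_ae_eq_integral => //.
- exact: emeasurable_sum.
- by move=> x _; apply: sume_ge0 => i _; rewrite mule_ge0.
apply: filterS sum_indic_part => x s1 _.
by rewrite -ge0_sume_distrl// sumEFin s1 mul1e.
Qed.

(** * Pair sums of abstract kernels *)

Section pair_sums.
Variables (k t : M -> M -> R).
Hypotheses (mk : measurable_fun setT (fun x => k x x))
  (mt : measurable_fun setT (fun p : M * M => t p.1 p.2))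
  (ktE : forall x y, k x y + t x y = (k x x + k y y) / 2)
  (t_ge0 : forall x y, 0 <= t x y)
  (t_le : forall x y, t x y <= k x x + k y y)
  (kint : mu.-integrable setT (EFin \o (fun x => k x x))).

Let k_ge0 x : 0 <= k x x.
Proof. have := t_ge0 x x; have := t_le x x; have := ktE x x; lra. Qed.

Lemma sum_pairsD_offdiag (X : N.-tuple M) :
  sum_pairs k X + sum_offdiag t X = N%:R * \sum_(i < N) k (tnth X i) (tnth X i).
Proof.
pose g i := k (tnth X i) (tnth X i).
(* Every ordered pair, equal indices included, contributes the mean of two diagonal values; each
   [g i] is then counted [N] times in all. *)
transitivity (\sum_(i < N) \sum_(j < N) (g i + g j) / 2).
  rewrite /sum_pairs /sum_offdiag -addrA -!big_split/=; apply: eq_bigr => i _.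
  rewrite [RHS](bigD1 i)//= -big_split/=.
  have -> : (g i + g i) / 2 = g i by lra.
  by congr (_ + _); apply: eq_bigr => j _; rewrite ktE.
rewrite (eq_bigr (fun i => (g i * N%:R + \sum_(j < N) g j) / 2)).
  rewrite -mulr_suml big_split/= -mulr_suml sumr_const card_ord -mulr_natr; lra.
by move=> i _; rewrite -mulr_suml big_split/= sumr_const card_ord mulr_natr.
Qed.

Let int_diag i : (omega V).-integrable (Omega V)
  (fun X => (k (tnth X i) (tnth X i))%:E).
Proof.
have mti := @measurable_tnth _ M N i.
apply/integrableP; split.
  apply/measurable_EFinP/measurable_funTS; exact: (measurableT_comp mk mti).
under eq_integral do rewrite gee0_abs ?lee_fin//.
rewrite (integral_omega_tnth i (g := fun x => (k x x)%:E))//; last first.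
  exact/measurable_EFinP.
apply: lte_mul_pinfty => //.
have /integrableP[_] := integrableS measurableT (mV i) (@subsetT _ _) kint.
by under eq_integral do rewrite /= ger0_norm//.
Qed.

Let int_sum_diag : (omega V).-integrable (Omega V)
  (fun X => (N%:R * \sum_(i < N) k (tnth X i) (tnth X i))%:E).
Proof.
apply: (eq_integrable measurable_Omega (fun X =>
    (N%:R%:E * \sum_(i < N) (k (tnth X i) (tnth X i))%:E)%E)).
  by move=> X _; rewrite EFinM sumEFin.
apply: (integrableZl measurable_Omega).
by apply: (integrable_sum measurable_Omega) => i _; exact: int_diag.
Qed.

Let int_offdiag :
  (omega V).-integrable (Omega V) (fun X => (sum_offdiag t X)%:E).
Proof.
have mO := measurable_Omega.
apply: (eq_integrable mO (fun X => (\sum_(i < N) \sum_(j < N | j != i)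
    (t (tnth X i) (tnth X j))%:E)%E)).
  by move=> X _; rewrite /sum_offdiag -sumEFin;
    apply: eq_bigr => i _; rewrite sumEFin.
apply: (integrable_sum mO) => i _; apply: (integrable_sum mO) => j _.
(* By [t_le] the off-diagonal term is dominated by diagonal ones, whose integrability comes from the
   marginals. *)
apply: (le_integrable mO) (integrableD mO (int_diag i) (int_diag j)).
  apply/measurable_EFinP/measurable_funTS.
  apply: (measurableT_comp mt (g := fun X : N.-tuple M => (tnth X i, tnth X j))).
  by apply: measurable_fun_pair; exact: measurable_tnth.
by move=> X _ /=; rewrite lee_fin !ger0_norm ?addr_ge0.
Qed.

(** Keeping [k] and [t] abstract lets the result serve both for a single radius and for kernels
    integrated against [xi]. *)
Lemma expect_sum_pairsD_offdiag :
  (expect V (sum_pairs k) + expect V (sum_offdiag t) =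
   ((\int[mu]_x k x x) * N%:R ^+ 2)%:E)%E.
Proof.
have mO := measurable_Omega.
(* The pair sum is written as a difference of two integrable functions; the finite expectation of
   the second then cancels. *)
rewrite /expect [X in (X + _)%E](_ : _ = \int[omega V]_(X in Omega V)
    ((N%:R * \sum_(i < N) k (tnth X i) (tnth X i))%:E - (sum_offdiag t X)%:E))%E.
  rewrite integralB// subeK; last exact: integrable_fin_num.
  under eq_integral do rewrite EFinM -sumEFin.
  rewrite integralZl//; last exact: integrable_sum.
  rewrite integral_sum//.
  rewrite (eq_bigr (fun i => N%:R%:E * \int[mu]_(x in V i) (k x x)%:E)%E); last first.
    move=> i _; apply: (integral_omega_tnth i (g := fun x => (k x x)%:E)) => //.
    exact/measurable_EFinP.
  rewrite -ge0_sume_distrr; last first.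
    by move=> i _; apply: integral_ge0 => x _; rewrite lee_fin.
  rewrite sum_integral_part//; last exact/measurable_EFinP.
  rewrite -[X in (_ * (_ * X))%E]fineK; last exact: integrable_fin_num kint.
  by rewrite -!EFinM mulrA mulrC expr2.
apply: eq_integral => X _; rewrite -sum_pairsD_offdiag.
by rewrite -EFinB addrK.
Qed.

End pair_sums.

End partition_expectation.

(** * Sigma-finiteness on the support of integrable functions *)

(** A maximum of [J] gives a constant sequence. Otherwise an element of [J] is chosen above each
    rational that has one. *)
Lemma cofinal_sequence (R : realType) (J : set R) : J !=set0 ->
  exists u : nat -> R,
    (forall n, J (u n)) /\ forall r, J r -> exists n, r <= u n.
Proof.
move=> [r0 Jr0].
have [[s Js sub]|nomax] := pselect (exists2 s, J s & forall r, J r -> r <= s).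
  by exists (fun=> s); split => // r Jr; exists 0%N; exact: sub.
pose above (q : rat) := [set r | J r /\ ratr q < r].
exists (fun n => if unpickle n is Some q then xget r0 (above q) else r0); split.
  by move=> n; case: unpickle => // q; case: xgetP => // r _ [].
move=> r Jr.
have [r' Jr' rr'] : exists2 r', J r' & r < r'.
  apply: contrapT => noabove; apply: nomax; exists r => // r' Jr'.
  by rewrite leNgt; apply/negP => rr'; apply: noabove; exists r'.
have [q] := rat_in_itvoo rr'; rewrite in_itv/= => /andP[rq qr'].
exists (pickle q); rewrite pickleK ltW// (lt_trans rq)//.
by have [] : above q (xget r0 (above q)) by apply: (@xgetI _ _ _ r').
Qed.

Definition joint_support T (R : numDomainType) (D : set T) (f : nat -> T -> R) :=
  D `&` [set x | exists n, 0 < f n x].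

Section sigma_finite_support.
Context d (T : measurableType d) (R : realType)
  (mu : {measure set T -> \bar R}) (D : set T) (mD : measurable D).
Variable f : nat -> T -> R.
Hypotheses (f_ge0 : forall n x, 0 <= f n x)
  (f_int : forall n, mu.-integrable D (EFin \o f n)).

Local Notation S := (joint_support D f).

Let level n k := D `&` [set x | k.+1%:R^-1%:E <= `|(f n x)%:E|]%E.

Let measurable_level n k : measurable (level n k).
Proof.
have /measurable_int mf := f_int n.
by apply: emeasurable_fun_c_infty => //; exact: measurableT_comp.
Qed.

Let mu_level n k : (mu (level n k) < +oo)%E.
Proof.
have /integrableP[mf] := f_int n; rewrite !ltey; apply: contra => /eqP muoo.
rewrite -leye_eq.
(* Markov's inequality: a level of infinite measure would make the integral of [f n] infinite. *)
apply: le_trans (le_integral_comp_abse mu mD (@measurable_id _ _ setT) _ _ mf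
  (_ : 0 < k.+1%:R^-1)) => //.
by rewrite [X in (_ * X)%E]muoo gt0_muley.
Qed.

Let joint_supportE : S = \bigcup_n \bigcup_k level n k.
Proof.
apply/seteqP; split=> x; last first.
  move=> [n _ [k _ [Dx /= kf]]]; split=> //; exists n.
  rewrite lee_fin ger0_norm// in kf; exact: lt_le_trans kf.
move=> [Dx [n fx]]; exists n => //.
have [k] := @ltr_add_invr R 0 _ fx; rewrite add0r => kf.
by exists k => //; split => //=; rewrite lee_fin ger0_norm// ltW.
Qed.

Lemma measurable_joint_support : measurable S.
Proof.
by rewrite joint_supportE; apply: bigcupT_measurable => n; exact: bigcupT_measurable.
Qed.

Lemma sigma_finite_joint_support :
  sigma_finite setT (mrestr mu measurable_joint_support).
Proof.
(* The complement of [S] is null for the restricted measure; adding it to every level makes the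
   family cover the whole space. *)
pose F m := ~` S `|` if unpickle m is Some nk then level nk.1 nk.2 else set0.
exists F.
  apply/esym/seteqP; split=> // x _.
  have [|Sx] := pselect (S x); last by exists 0%N => //; left.
  rewrite joint_supportE => -[n _ [k _ xl]].
  by exists (pickle (n, k)) => //; right; rewrite pickleK.
move=> m; rewrite /F; split.
  apply: measurableU; first exact/measurableC/measurable_joint_support.
  by case: unpickle.
rewrite /mrestr setIUl setICl set0U.
case: unpickle => [[n k]|]; last by rewrite set0I measure0.
have mS := measurable_joint_support.
rewrite (le_lt_trans _ (mu_level n k))// le_measure ?inE//.
exact: measurableI.
Qed.

Lemma integral_joint_support (h : T -> R) :
  (forall x, D x -> (forall n, f n x = 0) -> h x = 0) ->
  (\int[mu]_(x in D) (h x)%:E = \int[mu]_(x in S) (h x)%:E)%E.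
Proof.
move=> h0; rewrite integral_mkcond [RHS]integral_mkcond.
apply: eq_integral => x _; rewrite !patchE.
have [Sx|Sx] := boolP (x \in S).
  by rewrite ifT//; move: Sx; rewrite !inE => -[].
case: ifPn => // /[!inE] Dx; rewrite h0// => n; apply/eqP.
rewrite eq_le f_ge0 andbT leNgt; apply/negP => fx.
by move: Sx; rewrite notin_setE; apply; split => //; exists n.
Qed.

End sigma_finite_support.

(** * Radii at which the kernel vanishes *)

Section degenerate_radii.
Context (R : realType) d (M : measurableMetricType d R) (mu : probability M R).
Hypotheses (M_compact : compact [set: M]) (M_borel : borel_measurable M).

(** A centre [z] of a null ball of radius [r] lies in a ball of radius [r / 2] around some [q n].
    That ball is contained in the null one, so countably many null balls cover all such [z]. *)
Lemma measure_ball_ae_gt0 (r : R) : 0 < r ->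
  \forall z \ae mu, mu (ball z r) != 0%E.
Proof.
move=> r0; have [[x0 _]|M0] := pselect (exists x : M, True); last first.
  by apply: aeW => z; exfalso; apply: M0; exists z.
have [q q_dense] := compact_dense_sequence M_compact x0.
pose E n := if mu (ball (q n) (r / 2)) == 0%E then ball (q n) (r / 2) else set0.
apply: (@negligibleS _ _ _ mu (\bigcup_n E n)); last first.
  apply: negligible_bigcup => n; rewrite /E; case: ifPn => [/eqP mun|_].
    by apply/negligibleP => //; exact: measurable_metric_ball.
  exact: negligible_set0.
move=> z /= /negP/negPn/eqP muz.
have [n nz] := q_dense z (r / 2) ltac:(by rewrite divr_gt0).
exists n => //; rewrite /E ifT//; apply/eqP.
apply: (subset_measure0 _ _ _ muz); try exact: measurable_metric_ball.
move=> y ny; rewrite [r]splitr.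
exact: ball_triangle (ball_sym nz) ny.
Qed.

(** A vanishing integral of the square forces [Lambda mu r z y0 = 0] for almost every [z], so the
    measure of [ball z r] equals an indicator value, 0 or 1, and 0 is excluded almost everywhere. *)
Lemma lambda_r_diag_eq0 (r : R) (y0 : M) : 0 < r -> lambda_r mu r y0 y0 = 0 ->
  \forall z \ae mu, fine (mu (ball z r)) = 1.
Proof.
move=> r0 l0; have Lint := integrable_LambdaM mu M_compact M_borel r y0 y0.
have L0 : \forall z \ae mu, Lambda mu r z y0 * Lambda mu r z y0 = 0.
  have /ae_eq_integral_abs : (\int[mu]_z `|(EFin \o
      (fun z => Lambda mu r z y0 * Lambda mu r z y0)%R) z| = 0)%E.
    rewrite -[LHS]fineK.
      rewrite -[RHS]/(0%:E) -l0; congr (fine _)%:E; apply: eq_integral => z _.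
      by rewrite /= ger0_norm// -expr2 sqr_ge0.
    by apply: integrable_fin_num => //; exact: integrable_abse.
  move=> /(_ measurableT (measurable_int _ Lint)); apply: filterS => z /(_ I).
  by case.
apply: filterS2 L0 (measure_ball_ae_gt0 r0) => z /eqP.
rewrite mulf_eq0 orbb /Lambda subr_eq0 indicE => /eqP m01 mu0.
have : fine (mu (ball z r)) != 0.
  by rewrite fine_eq0// fin_num_measure//; exact: measurable_metric_ball.
by rewrite -m01; case: (_ \in _); rewrite //= eqxx.
Qed.

Lemma lambda_r_diagE (r : R) (y : M) :
  (\forall z \ae mu, fine (mu (ball z r)) = 1) ->
  lambda_r mu r y y = 1 - fine (mu (ball y r)).
Proof.
move=> m1; have mB := measurable_metric_ball M_borel y r.
have i1 : mu.-integrable setT (EFin \o (fun=> 1 : R)).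
  exact: finite_measure_integrable_cst.
have iB : mu.-integrable setT (EFin \o (\1_(ball y r) : M -> R)).
  exact: integrable_indic.
transitivity (\int[mu]_z (1 - \1_(ball y r) z)).
  congr fine; apply: ae_eq_integral => //.
  - exact: measurable_int (integrable_LambdaM mu M_compact M_borel r y y).
  - exact: measurable_int (integrableB measurableT i1 iB).
  apply: filterS m1 => z mz _; congr EFin; rewrite /Lambda mz !indicE.
  by rewrite (in_ball_sym z); case: (z \in _) => /=; ring.
rewrite RintegralB// Rintegral_probability_cst; congr (_ - _).
by rewrite /Rintegral integral_indic// setIT.
Qed.

Lemma lambda_r_diag_nonpos (r : R) (y : M) : r <= 0 -> lambda_r mu r y y = 0.
Proof.
move=> r0; rewrite /lambda_r.
have b0 z : ball z r = set0 :> set M.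
  apply/seteqP; split=> // x; rewrite ballEmdist/= => zx.
  by have := le_lt_trans (mdist_ge0 z x) zx; rewrite ltNge r0.
under eq_Rintegral do rewrite /Lambda b0 measure0 indicE in_set0 subrr mulr0.
by rewrite Rintegral_probability_cst.
Qed.

Lemma lambda_r_diag_test_points : exists y_ : nat -> M,
  forall r : R, (forall n, lambda_r mu r (y_ n) (y_ n) = 0) ->
  forall y, lambda_r mu r y y = 0.
Proof.
have [x0 _] : [set: M] !=set0.
  apply/set0P/eqP => M0; have := probability_setT mu.
  by rewrite M0 measure0 => /eqP; rewrite eq_sym onee_eq0.
(* [J] collects the radii at which almost every ball is full but some ball is not: there the
   diagonal kernel may vanish at one point and not at another. *)
pose J := [set r : R | (\forall z \ae mu, fine (mu (ball z r)) = 1) /\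
                       exists y, fine (mu (ball y r)) < 1].
have mu_le1 (r : R) (y : M) : fine (mu (ball y r)) <= 1.
  have mB := measurable_metric_ball M_borel y r.
  by rewrite -lee_fin fineK ?fin_num_measure//; exact: probability_le1.
have deg (y_ : nat -> M) (r : R) : 0 < r ->
    (forall n, lambda_r mu r (y_ n) (y_ n) = 0) ->
    (forall n, fine (mu (ball (y_ n) r)) = 1) /\
    forall y, lambda_r mu r y y != 0 -> J r.
  move=> r0 l0; have m1 := lambda_r_diag_eq0 r0 (l0 0%N); split=> [n|y].
    by have := l0 n; rewrite lambda_r_diagE// => /eqP; rewrite subr_eq0 => /eqP.
  rewrite lambda_r_diagE// subr_eq0 eq_sym => my; split=> //; exists y.
  by rewrite lt_neqAle my mu_le1.
have [J0|noJ] := pselect (J !=set0); last first.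
  exists (fun=> x0) => r l0 y.
  have [r0|r0] := ltP 0 r; last exact: lambda_r_diag_nonpos.
  have [_ Jr] := deg _ r r0 l0; apply/eqP/negPn/negP => /Jr ?.
  by apply: noJ; exists r.
have [u [Ju u_cofinal]] := cofinal_sequence J0.
(* The [n]-th test point is the centre of a ball of radius [u n] that is not full. For [r <= u n]
   its ball of radius [r] is not full either, so the kernel at [r] is detected. *)
exists (fun n => xget x0 [set y | fine (mu (ball y (u n))) < 1]) => r l0 y.
have [r0|r0] := ltP 0 r; last exact: lambda_r_diag_nonpos.
have [y1 Jr] := deg _ r r0 l0; apply/eqP/negPn/negP => /Jr/u_cofinal[n run].
have [_ [y' y'u]] := Ju n.
have /= := @xgetI _ x0 [set y | fine (mu (ball y (u n))) < 1] y' y'u.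
rewrite ltNge => /negP; apply; rewrite -[leLHS](y1 n).
apply: fine_le; rewrite ?fin_num_measure//; try exact: measurable_metric_ball.
apply: le_measure; rewrite ?inE; try exact: measurable_metric_ball.
exact: le_ball.
Qed.

End degenerate_radii.

(** * Integration over the radii *)

Section radius_measure.
Context (R : realType) d (M : measurableMetricType d R) (mu : probability M R).
Hypotheses (M_compact : compact [set: M]) (M_borel : borel_measurable M).
Variable xi : {measure set (measurableTypeR R) -> \bar R}.
Hypotheses
  (lambda_int : forall y1 y2 : M,
     xi.-integrable (radii M) (fun r => (lambda_r mu r y1 y2)%:E))
  (theta_int : forall y1 y2 : M,
     xi.-integrable (radii M) (fun r => (thetaDelta_r mu r y1 y2)%:E))
  (avg_int : xi.-integrable (radii M) (fun r => (avg_thetaDelta_r mu r)%:E)).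

Let mT : measurable (radii M : set (measurableTypeR R)) :=
  radii_measurable M_compact.

(** Tonelli's theorem is applied to [xi']; all kernels integrated below vanish at the radii where
    [xi'] may differ from [xi]. *)
Lemma sigma_finite_radii_measure :
  exists xi' : {sigma_finite_measure set (measurableTypeR R) -> \bar R},
    forall h : measurableTypeR R -> R,
    measurable_fun setT h -> (forall r, 0 <= h r) ->
    (forall r, (forall y, lambda_r mu r y y = 0) -> h r = 0) ->
    (\int[xi]_(r in radii M) (h r)%:E = \int[xi']_r (h r)%:E)%E.
Proof.
have [y_ y_test] := lambda_r_diag_test_points mu M_compact M_borel.
pose f n r := lambda_r mu r (y_ n) (y_ n).
have f_ge0 n r : 0 <= f n r by exact: lambda_r_ge0.
have f_int n : xi.-integrable (radii M) (EFin \o f n) by exact: lambda_int.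
have mS := measurable_joint_support mT f_ge0 f_int.
have sf := sigma_finite_joint_support mT f_ge0 f_int.
pose xi' : {sigma_finite_measure set (measurableTypeR R) -> \bar R} :=
  HB.pack (mrestr xi mS) (Measure_isSigmaFinite.Build _ _ _ (mrestr xi mS) sf).
exists xi' => h mh h0 hsupp.
transitivity (\int[xi]_(r in joint_support (radii M) f) (h r)%:E)%E.
  apply: (@integral_joint_support _ _ R xi (radii M) f f_ge0 h) => r _ fr.
  by apply: hsupp; exact: y_test.
by rewrite [RHS]ge0_integral_mrestr//; exact/measurable_EFinP.
Qed.

Let kernel_sum y1 y2 : lambda_xi mu xi y1 y2 + thetaDelta_xi mu xi y1 y2 =
  (lambda_xi mu xi y1 y1 + lambda_xi mu xi y2 y2) / 2.
Proof.
have intD := integrableD mT (lambda_int y1 y1) (lambda_int y2 y2).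
rewrite /lambda_xi /thetaDelta_xi -(RintegralD mT (lambda_int y1 y2)
  (theta_int y1 y2)) -(RintegralD mT (lambda_int y1 y1) (lambda_int y2 y2)).
rewrite -(RintegralZr _ mT intD).
by apply: eq_Rintegral => r _; exact: lambda_rD_thetaDelta_r.
Qed.

Let theta_ge0 y1 y2 : 0 <= thetaDelta_xi mu xi y1 y2.
Proof. by apply: Rintegral_ge0 => r _; exact: thetaDelta_r_ge0. Qed.

Let theta_le y1 y2 :
  thetaDelta_xi mu xi y1 y2 <= lambda_xi mu xi y1 y1 + lambda_xi mu xi y2 y2.
Proof.
have intD := integrableD mT (lambda_int y1 y1) (lambda_int y2 y2).
rewrite /lambda_xi -(RintegralD mT (lambda_int y1 y1) (lambda_int y2 y2)).
apply: (le_Rintegral mT (theta_int y1 y2) intD).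
by move=> r _; exact: thetaDelta_r_le.
Qed.

Let theta_supp r y1 y2 :
  (forall y, lambda_r mu r y y = 0) -> thetaDelta_r mu r y1 y2 = 0.
Proof.
move=> l0; apply/eqP; rewrite eq_le thetaDelta_r_ge0 andbT.
by rewrite (le_trans (thetaDelta_r_le mu M_compact M_borel r y1 y2))// !l0 addr0.
Qed.

Lemma measurable_thetaDelta_xi :
  measurable_fun setT (fun p : M * M => thetaDelta_xi mu xi p.1 p.2).
Proof.
have [xi' xi'E] := sigma_finite_radii_measure.
rewrite (_ : (fun p => _) = fine \o fun p : M * M =>
    \int[xi']_r (thetaDelta_r mu r p.1 p.2)%:E)%E.
  apply: measurableT_comp => //.
  pose f (q : (M * M) * measurableTypeR R) :=
    (thetaDelta_r mu q.2 q.1.1 q.1.2)%:E.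
  apply: (@measurable_fun_fubini_tonelli_F _ _ _ _ _ xi' f).
    apply/measurable_EFinP.
    apply: (measurable_thetaDelta_r mu M_compact M_borel (rho := snd)
      (a := fst \o fst) (b := snd \o fst)) => //; exact: measurableT_comp.
  by move=> q; rewrite lee_fin thetaDelta_r_ge0.
apply/funext => p /=; congr fine; apply: xi'E.
- exact: (measurable_thetaDelta_r mu M_compact M_borel
    (@measurable_id _ _ setT) (measurable_cst p.1) (measurable_cst p.2)).
- by move=> r; exact: thetaDelta_r_ge0.
- by move=> r; exact: theta_supp.
Qed.

Let f (q : M * measurableTypeR R) := (lambda_r mu q.2 q.1 q.1)%:E.

Let mf : measurable_fun setT f.
Proof.
apply/measurable_EFinP.
exact: (measurable_lambda_r_diag mu M_compact M_borel
  measurable_snd measurable_fst).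
Qed.

Let f_ge0 q : (0 <= f q)%E.
Proof. by rewrite lee_fin lambda_r_ge0. Qed.

Let avg_thetaDelta_rE_ereal r :
  (\int[mu]_x f (x, r) = (avg_thetaDelta_r mu r)%:E)%E.
Proof.
rewrite avg_thetaDelta_rE// fineK//.
by apply: integrable_fin_num => //; exact: integrable_lambda_r_diag.
Qed.

Let lambda_xi_diagE
    (xi' : {sigma_finite_measure set (measurableTypeR R) -> \bar R}) :
  (forall h : measurableTypeR R -> R,
    measurable_fun setT h -> (forall r, 0 <= h r) ->
    (forall r, (forall y, lambda_r mu r y y = 0) -> h r = 0) ->
    (\int[xi]_(r in radii M) (h r)%:E = \int[xi']_r (h r)%:E)%E) ->
  forall x, ((lambda_xi mu xi x x)%:E = \int[xi']_r f (x, r))%E.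
Proof.
move=> xi'E x; rewrite fineK; last exact: integrable_fin_num (lambda_int x x).
apply: xi'E => [|r|r]; last by apply.
- exact: (measurable_lambda_r_diag mu M_compact M_borel
    (@measurable_id _ _ setT) (measurable_cst x)).
- exact: lambda_r_ge0.
Qed.

Lemma measurable_lambda_xi_diag :
  measurable_fun setT (fun x => lambda_xi mu xi x x).
Proof.
have [xi' xi'E] := sigma_finite_radii_measure.
apply/measurable_EFinP.
rewrite (_ : EFin \o _ = fun x => \int[xi']_r f (x, r))%E.
  exact: (@measurable_fun_fubini_tonelli_F _ _ _ _ _ xi' f mf f_ge0).
by apply/funext => x; exact: lambda_xi_diagE.
Qed.

(** Tonelli exchanges [mu] and [xi'], and [avg_thetaDelta_rE] evaluates the inner integral. *)
Lemma integral_lambda_xi_diag :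
  (\int[mu]_x (lambda_xi mu xi x x)%:E = (avg_thetaDelta_xi mu xi)%:E)%E.
Proof.
have [xi' xi'E] := sigma_finite_radii_measure.
under eq_integral do rewrite (lambda_xi_diagE xi'E).
rewrite (fubini_tonelli f)//.
under eq_integral do rewrite avg_thetaDelta_rE_ereal.
rewrite fineK; last exact: integrable_fin_num avg_int.
(* Returning from [xi'] to [xi] is allowed since the average of [thetaDelta_r] also vanishes with
   the diagonal kernel. *)
apply/esym/xi'E => [|r|r l0].
- apply/measurable_EFinP.
  rewrite (_ : EFin \o _ = fun r => \int[mu]_x f (x, r))%E.
    exact: (@measurable_fun_fubini_tonelli_G _ _ _ _ _ mu f mf f_ge0).
  by apply/funext => r; rewrite avg_thetaDelta_rE_ereal.
- rewrite avg_thetaDelta_rE//.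
  by apply: Rintegral_ge0 => x _; exact: lambda_r_ge0.
- rewrite avg_thetaDelta_rE//; under eq_Rintegral do rewrite l0.
  exact: Rintegral_probability_cst.
Qed.

Lemma expect_radius_measure (N : nat) (V : equal_measure_partition mu N) :
  (expect V (sum_pairs (lambda_xi mu xi))
   + expect V (sum_offdiag (thetaDelta_xi mu xi))
   = (avg_thetaDelta_xi mu xi * N%:R ^+ 2)%:E)%E.
Proof.
have mk := measurable_lambda_xi_diag.
rewrite (expect_sum_pairsD_offdiag V mk measurable_thetaDelta_xi)//.
  by congr (_ * _)%:E; rewrite /Rintegral integral_lambda_xi_diag.
(* Integrability of the diagonal follows from its integral being the real number
   [avg_thetaDelta_xi mu xi]. *)
apply/integrableP; split; first exact/measurable_EFinP.
rewrite (eq_integral (fun x => (lambda_xi mu xi x x)%:E)) => [|x _ /=].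
  by rewrite integral_lambda_xi_diag ltry.
by rewrite ger0_norm// Rintegral_ge0// => r _; exact: lambda_r_ge0.
Qed.

End radius_measure.

Theorem theorem3p1 (R : realType) (d : measure_display)
    (M : measurableMetricType d R) (mu : probability M R)
    (N : nat) (V : equal_measure_partition mu N)
    (M_compact : compact [set: M]) (M_borel : borel_measurable M) :
  (forall r : R, radii M r ->
     (expect V (sum_pairs (lambda_r mu r))
      + expect V (sum_offdiag (thetaDelta_r mu r))
      = (avg_thetaDelta_r mu r * N%:R ^+ 2)%:E)%E) /\
  (forall xi : {measure set (measurableTypeR R) -> \bar R},
     (forall y1 y2 : M,
        xi.-integrable (radii M) (fun r => (lambda_r mu r y1 y2)%:E)) ->
     (forall y1 y2 : M,
        xi.-integrable (radii M) (fun r => (thetaDelta_r mu r y1 y2)%:E)) ->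
     xi.-integrable (radii M) (fun r => (avg_thetaDelta_r mu r)%:E) ->
     (expect V (sum_pairs (lambda_xi mu xi))
      + expect V (sum_offdiag (thetaDelta_xi mu xi))
      = (avg_thetaDelta_xi mu xi * N%:R ^+ 2)%:E)%E).
Proof.
split=> [r _|xi lambda_int theta_int avg_int]; last first.
  exact: expect_radius_measure.
rewrite expect_sum_pairsD_offdiag ?avg_thetaDelta_rE//.
- exact: (measurable_lambda_r_diag mu M_compact M_borel (measurable_cst r)
    (@measurable_id _ _ setT)).
- exact: (measurable_thetaDelta_r mu M_compact M_borel (measurable_cst r)
    measurable_fst measurable_snd).
- by move=> x y; exact: lambda_rD_thetaDelta_r.
- by move=> x y; exact: thetaDelta_r_ge0.
- by move=> x y; exact: thetaDelta_r_le.
- exact: integrable_lambda_r_diag.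
Qed.
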